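(* Let $N,M,r$ be positive integers and let $\xi^{1},\dots,\xi^{M}\in\{-1,+1\}^{N}$ be memory-vectors such that the Hamming distance between any two distinct memory-vectors is at least $\tau N$ for some $\tau>0$. Let $0<\rho<\frac{\tau}{2}$ and suppose $M\le \exp(2N(\tau-2\rho))\frac{1-e^{-2}}{2e^{2}}$. Let $E_{\mathrm{rand}}$ be the compact associative memory energy defined in the context, with FAVOR++ parameter $s\in(0,1)$ and constants $\widehat A,B,D$ as defined there. Fix $l\in\{1,\dots,M\}$, an input $\widehat{\xi}^{l}\in\{-1,+1\}^N$ at Hamming distance at most $\rho N$ from $\xi^l$, and a coordinate $i$; let $\tilde{\xi}^{l}$ be $\widehat{\xi}^{l}$ with its $i$-th coordinate negated and $\Delta(E_{\mathrm{rand}})=E_{\mathrm{rand}}(\tilde{\xi}^{l};\xi^1,\dots,\xi^M)-E_{\mathrm{rand}}(\widehat{\xi}^{l};\xi^1,\dots,\xi^M)$. Then (i) if $\widehat{\xi}^{l}_i=\xi^{l}_i$ then $\mathbb E[\Delta(E_{\mathrm{rand}})]>0$, and if $\widehat{\xi}^{l}_i=-\xi^{l}_i$ then $\mathbb E[\Delta(E_{\mathrm{rand}})]<0$; and (ii) $$\mathrm{Var}(\Delta(E_{\mathrm{rand}}))=\frac1r\big(V_1+V_2-2V_3-V_4-V_5+2V_6\big),$$ where, with all sums over $\mu_1,\mu_2\in\{1,\dots,M\}$, $V_1=\sum\Psi(\xi^{\mu_1}+\xi^{\mu_2}+2\widehat\xi^l)$, $V_2=\sum\Psi(\xi^{\mu_1}+\xi^{\mu_2}+2\tilde\xi^l)$,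 $V_3=\sum\Psi(\xi^{\mu_1}+\xi^{\mu_2}+\widehat\xi^l+\tilde\xi^l)$, $V_4=\sum\exp((\xi^{\mu_1})^\top\widehat\xi^l)\exp((\xi^{\mu_2})^\top\widehat\xi^l)$, $V_5=\sum\exp((\xi^{\mu_1})^\top\tilde\xi^l)\exp((\xi^{\mu_2})^\top\tilde\xi^l)$, $V_6=\sum\exp((\xi^{\mu_1})^\top\widehat\xi^l)\exp((\xi^{\mu_2})^\top\tilde\xi^l)$, and $$\Psi(\mathbf x)=D^{4}\exp(-2N)(1+8\widehat A)^{-N/2}\exp\Big(\frac{B^{2}}{2(1+8\widehat A)}\|\mathbf x\|^{2}\Big).$$
   Context: FAVOR++ random features: fix a parameter $s\in(0,1)$ and set $A=1-\frac{1}{s}$, $\widehat A=-A>0$, $B=\sqrt{1+4\widehat A}$, $C=-\frac12$, $D=(1+4\widehat A)^{N/4}$. For i.i.d. $\omega_1,\dots,\omega_r\sim\mathcal N(0,\mathbf I_N)$ define $\phi_{F++}:\mathbb R^N\to\mathbb R^r$ by $$\phi_{F++}(\mathbf z)=\frac{D}{\sqrt r}\Big(\exp\big(-\widehat A\|\omega_k\|_2^2+B\,\omega_k^\top\mathbf z+C\|\mathbf z\|_2^2\big)\Big)_{k=1}^{r}.$$ The compact associative memory energy of an input $\xi\in\{-1,+1\}^N$ given memories $\xi^1,\dots,\xi^M$ is $$E_{\mathrm{rand}}(\xi;\xi^1,\dots,\xi^M)=\phi_{F++}(\xi)^\top\mathbf M,\qquad \mathbf M=-\sum_{\mu=1}^{M}\phi_{F++}(\xi^{\mu}),$$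 with the same random vectors $\omega_k$ used throughout; expectations and variances are over $\omega_1,\dots,\omega_r$. *)

(* Defs.v *)
From HB Require Import structures.
From mathcomp Require Import all_boot all_order all_algebra.
From mathcomp Require Import all_classical all_reals all_analysis.

Set Implicit Arguments.
Unset Strict Implicit.
Unset Printing Implicit Defensive.

Import Order.TTheory GRing.Theory Num.Def Num.Theory.

Local Open Scope classical_set_scope.
Local Open Scope ring_scope.

Section Defs.
Context {R : realType}.

Definition dotp {N : nat} (x y : 'I_N -> R) : R := \sum_(j < N) x j * y j.
Definition normsq {N : nat} (x : 'I_N -> R) : R := \sum_(j < N) x j ^+ 2.

Definition pm1vec {N : nat} (x : 'I_N -> R) : Prop :=
  forall j, x j = 1 \/ x j = -1.

Definition hamming {N : nat} (x y : 'I_N -> R) : nat :=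
  #|[set j : 'I_N | x j != y j]|.

Definition flip {N : nat} (x : 'I_N -> R) (i : 'I_N) : 'I_N -> R :=
  fun j => if j == i then - x j else x j.

(* FAVOR++ constants: A = 1 - 1/s, Ahat = -A, B, C, D *)
Definition Ahat (s : R) : R := - (1 - s^-1).
Definition Bc (s : R) : R := Num.sqrt (1 + 4 * Ahat s).
Definition Cc : R := - (1 / 2).
Definition Dc (N : nat) (s : R) : R := (1 + 4 * Ahat s) `^ (N%:R / 4).

Definition phiFpp {N r : nat} (s : R) (omega : 'I_r -> 'I_N -> R)
  (z : 'I_N -> R) (k : 'I_r) : R :=
  Dc N s / Num.sqrt r%:R *
  expR (- Ahat s * normsq (omega k) + Bc s * dotp (omega k) z + Cc * normsq z).

Definition memM {N r M : nat} (s : R) (omega : 'I_r -> 'I_N -> R)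
  (xi : 'I_M -> 'I_N -> R) (k : 'I_r) : R :=
  - \sum_(mu < M) phiFpp s omega (xi mu) k.

Definition Erand {N r M : nat} (s : R) (omega : 'I_r -> 'I_N -> R)
  (xi : 'I_M -> 'I_N -> R) (x : 'I_N -> R) : R :=
  \sum_(k < r) phiFpp s omega x k * memM s omega xi k.

Definition Psi {N : nat} (s : R) (x : 'I_N -> R) : R :=
  Dc N s ^+ 4 * expR (- (2 * N%:R)) * (1 + 8 * Ahat s) `^ (- (N%:R / 2)) *
  expR (Bc s ^+ 2 / (2 * (1 + 8 * Ahat s)) * normsq x).

(* omega : 'I_r -> 'I_N -> random variables; all r*N coordinates are
   mutually independent standard normal: the joint law on every measurable
   rectangle is the product of N(0,1) laws. *)
Definition iid_std_normal {d} {T : measurableType d} (P : probability T R)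
  {r N : nat} (omega : 'I_r -> 'I_N -> {RV P >-> R}) : Prop :=
  forall A : 'I_r -> 'I_N -> set R,
    (forall k j, measurable (A k j)) ->
    P (\bigcap_(kj in [set: 'I_r * 'I_N]) (omega kj.1 kj.2 @^-1` A kj.1 kj.2))
    = (\prod_(kj : 'I_r * 'I_N) normal_prob 0 1 (A kj.1 kj.2))%E.

End Defs.

(* Main.v *)
Require Import Defs.
From HB Require Import structures.
From mathcomp Require Import all_boot all_order all_algebra.
From mathcomp Require Import all_classical all_reals all_analysis.
From mathcomp Require Import measurable_realfun simple_functions.
From mathcomp Require Import measurable_fun_approximation.
From mathcomp Require Import ring lra.

(* A product of two features is a multiple of exp(- a |w|^2 + w.b), whose
   Gaussian expectation is found by completing the square. Independence,
   given only on rectangles, extends to products of nonnegative functions, so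
   the energy difference, a finite linear combination of such exponentials,
   has an explicit mean and second moment; its rows are i.i.d., hence the
   factor 1/r in the variance. The mean is the exponential energy difference
   sum_mu (exp <xi^mu, xh> - exp <xi^mu, xt>), whose sign is that of the term
   of [xi l] because the bound on [M] makes the other terms negligible. *)

Import Order.TTheory GRing.Theory Num.Def Num.Theory.
Import HBNNSimple.
Local Open Scope classical_set_scope.
Local Open Scope ring_scope.

(** * Weighted change of variables, and expectations of products under a rectangle law *)

(** Both sides are additive in [f] and compatible with monotone limits, so the indicator case passes
    to simple functions and then to every nonnegative measurable [f]. It serves twice: with the
    other factors of an independent product as weight, and with the normal density as weight. *)
Lemma ge0_integral_weighted (R : realType) (d d' : measure_display)
    (T : measurableType d) (Y : measurableType d')
    (mu : {measure set T -> \bar R}) (nu : {measure set Y -> \bar R})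
    (X : T -> Y) (G : T -> R) (c : R) (f : Y -> R) :
  measurable_fun setT X -> measurable_fun setT G -> (forall t, 0 <= G t) ->
  0 <= c ->
  (forall A, measurable A ->
     (\int[mu]_t (\1_A (X t) * G t)%:E = c%:E * nu A)%E) ->
  measurable_fun setT f -> (forall y, 0 <= f y) ->
  (\int[mu]_t (f (X t) * G t)%:E = c%:E * \int[nu]_y (f y)%:E)%E.
Proof.
move=> mX mG G0 c0 muG mf f0.
have mEf : measurable_fun setT (EFin \o f) by exact/measurable_EFinP.
pose f_ := nnsfun_approx measurableT mEf.
have f_cvg y : (f_ n y)%:E @[n --> \oo] --> (f y)%:E.
  by apply: (cvg_nnsfun_approx measurableT mEf) => // x _; rewrite lee_fin.
have f_nd y m n : (m <= n)%N -> f_ m y <= f_ n y.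
  by move=> mn; exact/lefP/nd_nnsfun_approx.
have f_int n : (\int[mu]_t (f_ n (X t) * G t)%:E
              = c%:E * \int[nu]_y (f_ n y)%:E)%E.
  pose A k := f_ n @^-1` [set k].
  have mA k : measurable (A k) by exact: measurable_sfunP.
  (* A nonnegative simple function takes no negative value: for [k < 0] the level set is empty. So
     the terms are nonnegative for all real [k], as exchanging sum and integral demands. *)
  have A0 k x : 0 <= k * \1_(A k) x.
    have [k0|k0] := ltP k 0; last by rewrite mulr_ge0.
    by rewrite /A preimage_nnfun0// indic0 mulr0.
  have m1 k : measurable_fun setT (\1_(A k) : Y -> R) by exact: measurable_indic.
  transitivity (\sum_(k \in range (f_ n))
      \int[mu]_t (k * \1_(A k) (X t) * G t)%:E)%E.
    rewrite -ge0_integral_fsum//.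
    - by apply: eq_integral => t _; rewrite fsumEFin// fimfunE mulr_fsuml.
    - move=> k; apply/measurable_EFinP/measurable_funM => //.
      by apply: measurable_funM => //; exact: measurableT_comp.
    - by move=> k t _; rewrite lee_fin mulr_ge0.
  transitivity (\sum_(k \in range (f_ n))
      (c%:E * \int[nu]_y (k * \1_(A k) y)%:E))%E.
    apply: eq_fsbigr => k _.
    have [k0|k0] := ltP k 0.
      rewrite !integral0_eq ?mule0// => t _.
        by rewrite /A preimage_nnfun0// indic0 mulr0.
      by rewrite /A preimage_nnfun0// indic0 mulr0 mul0r.
    under eq_integral do rewrite -mulrA EFinM.
    rewrite ge0_integralZl//; last 2 first.
    - apply/measurable_EFinP/measurable_funM => //; exact: measurableT_comp.
    - by move=> t _; rewrite lee_fin mulr_ge0.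
    rewrite muG//.
    under [in RHS]eq_integral do rewrite EFinM.
    rewrite ge0_integralZl//; last exact/measurable_EFinP.
    by rewrite integral_indic// setIT muleCA.
  rewrite -ge0_mule_fsumr; last first.
    by move=> k; apply: integral_ge0 => y _; rewrite lee_fin.
  congr (_ * _)%E; rewrite -ge0_integral_fsum//.
  - by apply: eq_integral => t _; rewrite fsumEFin// -fimfunE.
  - by move=> k; apply/measurable_EFinP/measurable_funM.
  - by move=> k t _; rewrite lee_fin.
have mf_ n : measurable_fun setT (f_ n) by exact: measurable_funP.
have cvgR : (c%:E * \int[nu]_y (f_ n y)%:E)%E @[n --> \oo] -->
            (c%:E * \int[nu]_y (f y)%:E)%E.
  apply: cvgeZl => //.
  have -> : (\int[nu]_y (f y)%:E = \int[nu]_y limn (fun n => (f_ n y)%:E))%E.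
    by apply: eq_integral => y _; apply/esym/cvg_lim.
  apply: cvg_monotone_convergence => //.
  - by move=> n; exact/measurable_EFinP.
  - by move=> n y _; rewrite lee_fin.
  - by move=> y _ m n mn; rewrite lee_fin f_nd.
(* By monotone convergence under [mu], the same sequence also tends to the left-hand side. *)
apply: cvg_unique cvgR => //=.
under eq_fun do rewrite -f_int.
have -> : (\int[mu]_t (f (X t) * G t)%:E =
           \int[mu]_t limn (fun n => (f_ n (X t) * G t)%:E))%E.
  apply: eq_integral => t _; apply/esym/cvg_lim => //.
  under eq_fun do rewrite EFinM.
  by rewrite EFinM; exact: cvgeZr.
apply: cvg_monotone_convergence => //.
- move=> n; apply/measurable_EFinP/measurable_funM => //.
  exact: measurableT_comp.
- by move=> n t _; rewrite lee_fin mulr_ge0.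
- by move=> t _ m n mn; rewrite lee_fin ler_wpM2r// f_nd.
Qed.

(* The indicators of the rectangle law are replaced by the [f i] one index at
   a time; [s] lists the indices already replaced. *)
Lemma expectation_prod_rectangles (R : realType) (d d' : measure_display)
    (T : measurableType d) (Y : measurableType d') (P : probability T R)
    (I : finType) (nu : I -> probability Y R) (X : I -> T -> Y)
    (f : I -> Y -> R) (m : I -> R) :
  (forall i, measurable_fun setT (X i)) ->
  (forall A : I -> set Y, (forall i, measurable (A i)) ->
     P (\bigcap_(i in [set: I]) (X i @^-1` A i)) = (\prod_i nu i (A i))%E) ->
  (forall i, measurable_fun setT (f i)) -> (forall i y, 0 <= f i y) ->
  (forall i, \int[nu i]_y (f i y)%:E = (m i)%:E)%E ->
  (\int[P]_t (\prod_i f i (X i t))%:E = (\prod_i m i)%:E)%E.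
Proof.
move=> mX rect.
(* [f] and [m] are quantified inside the induction because its step trades one [f i] for an
   indicator. *)
suff step (s : seq I) : forall (f : I -> Y -> R) (m : I -> R),
    (forall i, i \notin s -> exists2 A, measurable A & f i = \1_A) ->
    (forall i, measurable_fun setT (f i)) -> (forall i y, 0 <= f i y) ->
    (forall i, \int[nu i]_y (f i y)%:E = (m i)%:E)%E ->
    (\int[P]_t (\prod_i f i (X i t))%:E = (\prod_i m i)%:E)%E.
  by apply: (step (enum I)) => i; rewrite mem_enum.
elim: s => [|i s IH] {}f {}m fs mf f0 fm.
  (* Base case: all factors are indicators, and their product is the indicator of the intersection
     whose probability [rect] gives. *)
  have {}fs i : {A | measurable A & f i = \1_A} by exact/cid2/fs.
  pose A i := s2val (fs i).
  have mA i : measurable (A i) by rewrite /A; case: (fs i).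
  have fA i : f i = \1_(A i) by rewrite /A; case: (fs i).
  rewrite -prodEFin.
  transitivity (\prod_i nu i (A i))%E; last first.
    apply: eq_bigr => i _; rewrite -fm fA.
    by rewrite integral_indic// setIT.
  rewrite -rect//.
  transitivity (\int[P]_t
      (\1_(\bigcap_(i in [set: I]) (X i @^-1` A i)) t)%:E)%E.
    apply: eq_integral => t _; congr EFin.
    under eq_bigr do rewrite fA.
    rewrite indicE; case: (boolP (t \in _)) => [|tA].
      rewrite inE => tA; apply: big1 => j _.
      by rewrite indicE mem_set//; exact: (tA j).
    have [j] : exists j, ~ A j (X j t).
      by apply/existsNP => tA'; case/negP: tA; rewrite inE => j _; exact: tA'.
    by move=> Aj; rewrite (bigD1 j)//= indicE memNset// mul0r.
  rewrite integral_indic ?setIT//.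
  apply: fin_bigcap_measurable => // j _.
  by rewrite -[X in measurable X]setTI; exact: mX.
(* The factors other than the [i]-th form the weight [G], and [c] is the product of their means. It
   then suffices to treat an indicator in place of [f i]. *)
pose G t := \prod_(j | j != i) f j (X j t).
pose c := \prod_(j | j != i) m j.
have m0 j : 0 <= m j.
  by rewrite -lee_fin -fm; apply: integral_ge0 => y _; rewrite lee_fin.
rewrite (bigD1 i)//= EFinM -fm muleC.
under eq_integral do rewrite (bigD1 i)//=.
apply: (@ge0_integral_weighted _ _ _ _ _ _ _ (X i) G c) => //.
- rewrite /G; under eq_fun do rewrite big_mkcond/=.
  apply: measurable_prod => j _; case: (j != i) => //.
  exact: (measurableT_comp (mf j) (mX j)).
- by move=> t; apply: prodr_ge0.
- exact: prodr_ge0.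
move=> A mA.
(* With [\1_A] in position [i], the family consists of indicators outside the shorter list, so the
   induction hypothesis applies. *)
pose f' j := if j == i then \1_A else f j.
pose m' j := if j == i then fine (nu i A) else m j.
have f'i : f' i = \1_A by rewrite /f' eqxx.
have m'i : m' i = fine (nu i A) by rewrite /m' eqxx.
have cE : c = \prod_(j | j != i) m' j.
  by apply: eq_bigr => j /negbTE ji; rewrite /m' ji.
transitivity (\int[P]_t (\prod_j f' j (X j t))%:E)%E.
  apply: eq_integral => t _; rewrite [in RHS](bigD1 i)//= f'i.
  congr (_ * _)%:E.
  by apply: eq_bigr => j /negbTE ji; rewrite /f' ji.
have -> : (c%:E * nu i A = (\prod_j m' j)%:E)%E.
  rewrite [in RHS](bigD1 i)//= m'i -cE EFinM fineK ?fin_num_measure//.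
  by rewrite muleC.
apply: IH.
- move=> j js; rewrite /f'; case: eqVneq => [_|ji]; first by exists A.
  by apply: fs; rewrite inE negb_or ji.
- by move=> j; rewrite /f'; case: eqVneq => // _; exact: measurable_indic.
- by move=> j y; rewrite /f'; case: eqVneq.
- move=> j; rewrite /f' /m'; case: eqVneq => [->|//].
  by rewrite integral_indic// setIT fineK ?fin_num_measure.
Qed.

(** * One-dimensional Gaussian integrals *)

(** [normal_prob] of a set is by definition the integral of the density over it, which is the
    indicator case required by the weighted lemma with [X] the identity. *)
Lemma ge0_integral_normal_prob (R : realType) (m s : R) (f : R -> R) :
  measurable_fun setT f -> (forall x, 0 <= f x) ->
  (\int[normal_prob m s]_x (f x)%:E =
   \int[lebesgue_measure]_x (f x * normal_pdf m s x)%:E)%E.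
Proof.
move=> mf f0; rewrite -[LHS]mul1e; apply/esym.
apply: (@ge0_integral_weighted R _ _ _ _ lebesgue_measure (normal_prob m s) idfun
  (normal_pdf m s) 1 f) => //.
- exact: measurable_id.
- exact: measurable_normal_pdf.
- by move=> x; exact: normal_pdf_ge0.
move=> A mA; rewrite mul1e /= /normal_prob [RHS]integral_mkcond.
apply: eq_integral => x _; rewrite patchE indicE.
by case: ifPn; rewrite ?mul1r ?mul0r.
Qed.

(** Completing the square with [v = 1 + 2 * a]: the integrand times the standard density is the
    constant [K] times the normal density of mean [b / v] and variance [1 / v], whose total mass is
    1. *)
Lemma integral_normal_prob_expR_quadratic (R : realType) (a b : R) : 0 <= a ->
  (\int[normal_prob 0 1]_x (expR (- a * x ^+ 2 + b * x))%:E =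
   ((1 + 2 * a) `^ (- 2^-1) * expR (b ^+ 2 / (2 * (1 + 2 * a))))%:E)%E.
Proof.
move=> a0; set v := 1 + 2 * a.
have v0 : 0 < v by rewrite /v; lra.
have sv0 : 0 < Num.sqrt v by rewrite sqrtr_gt0.
have s0 : (Num.sqrt v)^-1 != 0 by rewrite invr_eq0 gt_eqF.
set K := v `^ _ * _.
have K0 : 0 <= K by rewrite mulr_ge0 ?powR_ge0 ?expR_ge0.
rewrite ge0_integral_normal_prob//; last first.
  apply: measurableT_comp => //.
  by apply: measurable_funD; apply: measurable_funM => //; exact: measurable_funX.
transitivity (\int[lebesgue_measure]_x
    (K%:E * (normal_pdf (b / v) (Num.sqrt v)^-1 x)%:E))%E; last first.
  rewrite ge0_integralZl//.
  - by rewrite integral_normal_pdf mule1.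
  - by apply/measurable_EFinP; exact: measurable_normal_pdf.
  - by move=> x _; rewrite lee_fin normal_pdf_ge0.
apply: eq_integral => x _; rewrite -EFinM; congr EFin.
rewrite !normal_pdfE ?oner_neq0// /normal_peak /normal_fun /K.
rewrite powRN powR12_sqrt ?ltW//.
have -> : Num.sqrt ((Num.sqrt v)^-1 ^+ 2 * pi *+ 2) =
          (Num.sqrt v)^-1 * Num.sqrt (1 ^+ 2 * pi *+ 2) :> R.
  rewrite -mulrnAr sqrtrM ?sqr_ge0// sqrtr_sqr ger0_norm ?invr_ge0 ?ltW//.
  by rewrite expr1n mul1r.
have p0 : Num.sqrt (1 ^+ 2 * pi *+ 2) != 0 :> R.
  by rewrite gt_eqF// sqrtr_gt0 expr1n mul1r mulrn_wgt0// pi_gt0.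
rewrite mulrCA -expRD.
have -> : - a * x ^+ 2 + b * x + - (x - 0) ^+ 2 / (1 ^+ 2 *+ 2) =
  b ^+ 2 / (2 * v) + - (x - b / v) ^+ 2 / ((Num.sqrt v)^-1 ^+ 2 *+ 2).
  rewrite exprVn sqr_sqrtr ?ltW//.
  have v0' : v != 0 by rewrite gt_eqF.
  have -> : a = (v - 1) / 2 by rewrite /v; field.
  by field.
rewrite expRD; field.
by rewrite p0 gt_eqF.
Qed.

(** * Exponentials of Gaussian rows and their expectations *)

Section gaussian_rows.
Context {R : realType} {d : measure_display} {T : measurableType d}.
Context {P : probability T R} {r N : nat}.
Implicit Types (a : R) (b : 'I_N -> R) (k : 'I_r).

(* [gmgf a b] is the expectation of exp(- a |w|^2 + w.b) for w ~ N(0, I_N). *)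
Definition gmgf a b : R :=
  (1 + 2 * a) `^ (- (N%:R / 2)) * expR (normsq b / (2 * (1 + 2 * a))).

Lemma gmgf_prod a b :
  \prod_(j < N) ((1 + 2 * a) `^ (- 2^-1) * expR (b j ^+ 2 / (2 * (1 + 2 * a))))
  = gmgf a b.
Proof.
rewrite big_split/= prodr_const card_ord -powR_mulrn ?powR_ge0//.
rewrite -powRrM -expR_sum -mulr_suml /gmgf /normsq.
by congr (_ `^ _ * _); field.
Qed.

Lemma gmgf0 : gmgf 0 (fun=> 0) = 1.
Proof.
rewrite /gmgf /normsq big1 => [|j _]; last by rewrite expr0n.
by rewrite mulr0 addr0 powR1 mul0r expR0 mulr1.
Qed.

Variable omega : 'I_r -> 'I_N -> {RV P >-> R}.
Hypothesis iid : iid_std_normal omega.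

Definition gexp a b k (t : T) : R :=
  expR (- a * normsq (omega k ^~ t) + dotp (omega k ^~ t) b).

Lemma gexp_ge0 a b k t : 0 <= gexp a b k t. Proof. exact: expR_ge0. Qed.

Lemma gexp0 k t : gexp 0 (fun=> 0) k t = 1.
Proof.
rewrite /gexp oppr0 mul0r add0r /dotp big1 ?expR0// => j _.
by rewrite mulr0.
Qed.

(** Exponentials of one row are closed under products, so a second moment within a row is again a
    value of [gmgf]. *)
Lemma gexpM a b a' b' k t :
  gexp a b k t * gexp a' b' k t = gexp (a + a') (fun j => b j + b' j) k t.
Proof.
rewrite /gexp -expRD; congr expR; rewrite /dotp.
under [in RHS]eq_bigr do rewrite mulrDr.
by rewrite big_split/=; ring.
Qed.

Lemma gexp_prod a b k t :
  gexp a b k t = \prod_(j < N) expR (- a * omega k j t ^+ 2 + b j * omega k j t).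
Proof.
rewrite -expR_sum big_split/= -mulr_sumr; congr (expR (_ + _)).
by apply: eq_bigr => j _; rewrite mulrC.
Qed.

Lemma measurable_gexp a b k : measurable_fun setT (gexp a b k).
Proof.
rewrite (funext (gexp_prod a b k)).
apply: measurable_prod => j _; apply: measurableT_comp => //.
apply: measurable_funD; apply: measurable_funM => //.
exact: measurable_funX.
Qed.

(** Each row exponential splits over its coordinates, and all [r * N] coordinates are independent;
    what remains is a product of one-dimensional Gaussian integrals. *)
Lemma integral_prod_gexp (a : 'I_r -> R) (b : 'I_r -> 'I_N -> R) :
  (forall k, 0 <= a k) ->
  (\int[P]_t (\prod_(k < r) gexp (a k) (b k) k t)%:E =
   (\prod_(k < r) gmgf (a k) (b k))%:E)%E.
Proof.
move=> a0.
pose f (kj : 'I_r * 'I_N) x := expR (- a kj.1 * x ^+ 2 + b kj.1 kj.2 * x).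
pose m (kj : 'I_r * 'I_N) := (1 + 2 * a kj.1) `^ (- 2^-1) *
  expR (b kj.1 kj.2 ^+ 2 / (2 * (1 + 2 * a kj.1))).
have mf kj : measurable_fun setT (f kj).
  apply: measurableT_comp => //.
  by apply: measurable_funD; apply: measurable_funM => //; exact: measurable_funX.
transitivity (\int[P]_t (\prod_kj f kj (omega kj.1 kj.2 t))%:E)%E.
  apply: eq_integral => t _; congr EFin.
  rewrite -(pair_bigA _ (fun k j => f (k, j) (omega k j t)))/=.
  by apply: eq_bigr => k _; rewrite gexp_prod.
transitivity (\prod_kj m kj)%:E; last first.
  rewrite -(pair_bigA _ (fun k j => m (k, j)))/=; congr EFin.
  by apply: eq_bigr => k _; rewrite -gmgf_prod.
apply: (@expectation_prod_rectangles R _ _ _ _ P _ (fun=> normal_prob 0 1)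
  (fun kj => omega kj.1 kj.2)) => //.
- by move=> kj; exact: (measurable_funP (omega kj.1 kj.2)).
- move=> A mA; have := iid (fun k j => A (k, j)) (fun k j => mA (k, j)).
  have -> : \bigcap_(kj in [set: 'I_r * 'I_N])
      (omega kj.1 kj.2 @^-1` A (kj.1, kj.2)) =
    \bigcap_(kj in [set: 'I_r * 'I_N]) (omega kj.1 kj.2 @^-1` A kj).
    by apply: eq_bigcapr => -[].
  by move=> ->; apply: eq_bigr => -[].
- by move=> kj x; exact: expR_ge0.
- by move=> kj; exact: integral_normal_prob_expR_quadratic.
Qed.

Lemma integral_gexp a b k : 0 <= a ->
  (\int[P]_t (gexp a b k t)%:E = (gmgf a b)%:E)%E.
Proof.
move=> a0.
(* The other rows get parameters 0, for which both [gexp] and its expectation equal 1. *)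
pose a_ k' := if k' == k then a else 0.
pose b_ k' := if k' == k then b else fun=> 0.
have := @integral_prod_gexp a_ b_.
rewrite [in RHS](bigD1 k)//= /a_ /b_ eqxx [X in _ * X]big1 ?mulr1 => [|k']; last first.
  by move=> /negbTE ->; rewrite gmgf0.
move=> <- => [|k']; last by case: ifP.
apply: eq_integral => t _; rewrite (bigD1 k)//= eqxx big1 ?mulr1 => [//|k'].
by move=> /negbTE ->; rewrite gexp0.
Qed.

Lemma integral_gexpM a b k a' b' k' : 0 <= a -> 0 <= a' -> k != k' ->
  (\int[P]_t (gexp a b k t * gexp a' b' k' t)%:E =
   (gmgf a b * gmgf a' b')%:E)%E.
Proof.
move=> a0 a0' kk'.
pose a_ h := if h == k then a else if h == k' then a' else 0.
pose b_ h := if h == k then b else if h == k' then b' else fun=> 0.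
have k'k : (k' == k) = false by rewrite eq_sym (negbTE kk').
transitivity (\prod_(h < r) gmgf (a_ h) (b_ h))%:E.
  rewrite -integral_prod_gexp => [|h]; last first.
    by rewrite /a_; case: ifP => // _; case: ifP.
  apply: eq_integral => t _.
  rewrite (bigD1 k)//= (bigD1 k')/=; last by rewrite k'k.
  rewrite /a_ /b_ !eqxx k'k big1 ?mulr1// => h /andP[/negbTE -> /negbTE ->].
  by rewrite gexp0.
rewrite (bigD1 k)//= (bigD1 k')/=; last by rewrite k'k.
rewrite /a_ /b_ !eqxx k'k big1 ?mulr1// => h /andP[/negbTE -> /negbTE ->].
by rewrite gmgf0.
Qed.

Lemma Lfun1_gexp a b k : 0 <= a -> gexp a b k \in Lfun P 1.
Proof.
move=> a0; apply/Lfun1_integrable/integrableP; split.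
  by apply/measurable_EFinP; exact: measurable_gexp.
under eq_integral do rewrite /= ger0_norm ?gexp_ge0//.
by rewrite integral_gexp// ltry.
Qed.

Lemma Lfun1_gexpM a b k a' b' k' : 0 <= a -> 0 <= a' ->
  (fun t => gexp a b k t * gexp a' b' k' t) \in Lfun P 1.
Proof.
move=> a0 a0'; have [->|kk'] := eqVneq k k'.
  by under eq_fun do rewrite gexpM; apply: Lfun1_gexp; rewrite addr_ge0.
apply/Lfun1_integrable/integrableP; split.
  by apply/measurable_EFinP/measurable_funM; exact: measurable_gexp.
under eq_integral do rewrite /= ger0_norm ?mulr_ge0 ?gexp_ge0//.
by rewrite integral_gexpM// ltry.
Qed.

End gaussian_rows.

(** * Mean and variance of linear combinations of row exponentials *)

Lemma expectation_lincomb (R : realType) (d : measure_display)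
    (T : measurableType d) (P : probability T R) (I : finType)
    (c m : I -> R) (F : I -> T -> R) :
  (forall i, F i \in Lfun P 1) ->
  (forall i, \int[P]_t (F i t)%:E = (m i)%:E)%E ->
  (fun t => \sum_i c i * F i t) \in Lfun P 1 /\
  'E_P[(fun t => \sum_i c i * F i t)%R]%E = (\sum_i c i * m i)%:E.
Proof.
move=> F1 Fm.
have iF i : P.-integrable setT (fun t => (c i)%:E * (F i t)%:E)%E.
  by apply: integrableZl => //; exact/Lfun1_integrable.
have E t : (\sum_i c i * F i t)%:E = (\sum_i (c i)%:E * (F i t)%:E)%E.
  by rewrite -sumEFin; apply: eq_bigr => i _; rewrite EFinM.
split.
  apply/Lfun1_integrable; rewrite /comp (funext E).
  exact: integrable_sum.
rewrite unlock; under eq_integral do rewrite E.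
rewrite integral_sum// -sumEFin; apply: eq_bigr => i _.
by rewrite integralZl// ?Fm// ; exact/Lfun1_integrable.
Qed.

(* The rows of [omega] are i.i.d., so the variance of the sum over [k] is [r]
   times the variance of one summand. *)
Lemma moments_sum_gexp (R : realType) (d : measure_display)
    (T : measurableType d) (P : probability T R) (r N : nat)
    (omega : 'I_r -> 'I_N -> {RV P >-> R}) (J : finType) (a : R) (c : J -> R)
    (b : J -> 'I_N -> R) :
  iid_std_normal omega -> 0 <= a ->
  let X := fun t => \sum_(k < r) \sum_q c q * gexp omega a (b q) k t in
  let S1 := \sum_q c q * gmgf a (b q) in
  let S2 := \sum_q \sum_q' c q * c q' *
              gmgf (a + a) (fun j => b q j + b q' j) in
  'E_P[X]%E = (r%:R * S1)%:E /\ 'V_P[X] = (r%:R * (S2 - S1 ^+ 2))%:E.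
Proof.
move=> iid a0 X S1 S2.
have XE : X = fun t => \sum_(p : 'I_r * J) c p.2 * gexp omega a (b p.2) p.1 t.
  by apply/funext => t; rewrite /X pair_bigA.
have [X1 EX] := @expectation_lincomb _ _ _ P ('I_r * J)%type (fun p => c p.2)
  (fun p => gmgf a (b p.2)) (fun p => gexp omega a (b p.2) p.1)
  (fun p => Lfun1_gexp _ iid _ _ _ a0)
  (fun p => integral_gexp _ iid _ _ _ a0).
rewrite -XE in X1 EX.
have S1E : \sum_(p : 'I_r * J) c p.2 * gmgf a (b p.2) = r%:R * S1.
  rewrite -(pair_bigA _ (fun _ q => c q * gmgf a (b q)))/=.
  by rewrite sumr_const card_ord mulr_natl.
rewrite S1E in EX.
split=> //.
(* [X ^ 2] is expanded over pairs of rows and pairs of terms. A term with equal rows merges by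
   [gexpM]; one with distinct rows factors by independence. *)
pose I := (('I_r * 'I_r) * (J * J))%type.
pose C (p : I) := c p.2.1 * c p.2.2.
pose F (p : I) t := gexp omega a (b p.2.1) p.1.1 t * gexp omega a (b p.2.2) p.1.2 t.
pose m (p : I) := if p.1.1 == p.1.2
  then gmgf (a + a) (fun j => b p.2.1 j + b p.2.2 j)
  else gmgf a (b p.2.1) * gmgf a (b p.2.2).
have F1 p : F p \in Lfun P 1 by exact: Lfun1_gexpM.
have Fm p : (\int[P]_t (F p t)%:E = (m p)%:E)%E.
  rewrite /F /m; case: eqVneq => [->|kk'].
    under eq_integral do rewrite gexpM.
    by rewrite integral_gexp// addr_ge0.
  exact: integral_gexpM.
have [XX1 EXX] := @expectation_lincomb _ _ _ P I C m F F1 Fm.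
have XXE : (fun t => \sum_p C p * F p t) = (X * X)%R.
  apply/funext => t; rewrite !fctE /X.
  rewrite -(pair_bigA _ (fun kk qq => C (kk, qq) * F (kk, qq) t))/=.
  rewrite -(pair_bigA _ (fun k k' => \sum_qq C ((k, k'), qq) * F ((k, k'), qq) t))/=.
  rewrite mulr_suml; apply: eq_bigr => k _.
  rewrite mulr_sumr; apply: eq_bigr => k' _.
  rewrite -(pair_bigA _ (fun q q' => C ((k, k'), (q, q')) * F ((k, k'), (q, q')) t))/=.
  rewrite mulr_suml; apply: eq_bigr => q _.
  by rewrite mulr_sumr; apply: eq_bigr => q' _; rewrite /C /F/=; ring.
rewrite XXE in XX1 EXX.
rewrite /variance covarianceE// EXX EX -EFinM -EFinB; congr EFin.
have -> : \sum_p C p * m p = \sum_(k < r) \sum_(k' < r)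
    if k == k' then S2 else S1 ^+ 2.
  rewrite -(pair_bigA _ (fun kk qq => C (kk, qq) * m (kk, qq)))/=.
  rewrite -(pair_bigA _ (fun k k' => \sum_qq C ((k, k'), qq) * m ((k, k'), qq)))/=.
  apply: eq_bigr => k _; apply: eq_bigr => k' _.
  rewrite -(pair_bigA _ (fun q q' => C ((k, k'), (q, q')) * m ((k, k'), (q, q'))))/=.
  rewrite /C /m/=; case: eqVneq => // _.
  rewrite expr2 /S1 mulr_suml; apply: eq_bigr => q _.
  by rewrite mulr_sumr; apply: eq_bigr => q' _; ring.
(* Each row meets itself once and [r - 1] others. This form makes the subtraction of [(r S1)^2]
   leave [r (S2 - S1^2)]. *)
have -> : \sum_(k < r) \sum_(k' < r) (if k == k' then S2 else S1 ^+ 2) =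
    \sum_(k < r) (S2 - S1 ^+ 2 + r%:R * S1 ^+ 2).
  apply: eq_bigr => k _.
  rewrite (eq_bigr (fun k' => (if k' == k then S2 - S1 ^+ 2 else 0) + S1 ^+ 2)).
    rewrite big_split/= -big_mkcond big_pred1_eq sumr_const card_ord.
    by rewrite [in RHS]mulr_natl.
  by move=> k' _; rewrite eq_sym; case: eqP => _; ring.
by rewrite sumr_const card_ord -mulr_natl; ring.
Qed.

(** * Sign vectors, Hamming distance and the sign of the energy gap *)

Section sign_vectors.
Context {R : realType} {N : nat}.
Implicit Types x y z : 'I_N -> R.

Lemma hammingE x y : (hamming x y)%:R = \sum_(j < N) (x j != y j)%:R :> R.
Proof.
rewrite /hamming -sum1_card natr_sum big_mkcond; apply: eq_bigr => j _.
have -> : (j \in in_set [set j | x j != y j]) = (x j != y j) by exact: asboolb.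
by case: (x j != y j).
Qed.

Lemma hamming_sym x y : hamming x y = hamming y x.
Proof.
apply/eqP; rewrite -(eqr_nat R) !hammingE; apply/eqP.
by apply: eq_bigr => j _; rewrite eq_sym.
Qed.

Lemma hamming_triangle x y z :
  (hamming x z)%:R <= (hamming x y)%:R + (hamming y z)%:R :> R.
Proof.
rewrite !hammingE -big_split/=; apply: ler_sum => j _.
rewrite -natrD ler_nat; have [->|xy] := eqVneq (x j) (y j); first by case: eqP.
by case: (x j != z j).
Qed.

Lemma normsq_pm1 x : pm1vec x -> normsq x = N%:R.
Proof.
move=> x1; rewrite /normsq (eq_bigr (fun=> 1)) ?sumr_const ?card_ord// => j _.
by case: (x1 j) => ->; rewrite ?sqrrN expr1n.
Qed.

(** An agreeing coordinate contributes 1 and a disagreeing one -1. *)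
Lemma dotp_pm1 x y : pm1vec x -> pm1vec y ->
  dotp x y = N%:R - 2 * (hamming x y)%:R.
Proof.
move=> x1 y1; rewrite hammingE /dotp mulr_sumr.
have -> : N%:R = \sum_(j < N) (1 : R) by rewrite sumr_const card_ord.
rewrite -sumrB; apply: eq_bigr => j _.
have ne : (1 : R) != -1 by rewrite gt_eqF//; lra.
case: (x1 j) => ->; case: (y1 j) => ->.
- by rewrite eqxx/=; ring.
- by rewrite ne/=; ring.
- by rewrite eq_sym ne/=; ring.
- by rewrite eqxx/=; ring.
Qed.

Lemma dotp_flip x y i : dotp x (flip y i) = dotp x y - 2 * (x i * y i).
Proof.
rewrite /dotp (bigD1 i)//= [in RHS](bigD1 i)//= /flip eqxx.
rewrite (eq_bigr (fun j => x j * y j)); first by ring.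
by move=> j /negbTE ->.
Qed.

Lemma normsq_add_pm1 x y : pm1vec x -> pm1vec y ->
  normsq (fun j => x j + y j) = 2 * N%:R + 2 * dotp x y.
Proof.
move=> x1 y1; rewrite -{1}(normsq_pm1 _ x1).
have -> : 2 * normsq x = normsq x + normsq y by rewrite !normsq_pm1//; ring.
rewrite /normsq /dotp mulr_sumr -!big_split/=.
by apply: eq_bigr => j _; ring.
Qed.

Lemma flip_pm1 x i : pm1vec x -> pm1vec (flip x i).
Proof.
move=> x1 j; rewrite /flip; case: ifP => // _.
by case: (x1 j) => ->; [right|left]; rewrite ?opprK.
Qed.

End sign_vectors.

(* The pattern [xi l] contributes at least exp(N - 2 rho N) (1 - e^-2) in
   absolute value, while every other pattern is at distance at least
   (tau - rho) N from [xh]; the bound on [M] makes all of these together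
   contribute at most half as much. *)
Lemma energy_gap_sign (R : realType) (N M : nat) (tau rho : R)
    (xi : 'I_M -> 'I_N -> R) (l : 'I_M) (xh : 'I_N -> R) (i : 'I_N) :
  (forall mu, pm1vec (xi mu)) ->
  (forall mu nu : 'I_M, mu != nu ->
     tau * N%:R <= (hamming (xi mu) (xi nu))%:R) ->
  M%:R <= expR (2 * N%:R * (tau - 2 * rho)) * (1 - expR (-2)) / (2 * expR 2) ->
  pm1vec xh ->
  (hamming xh (xi l))%:R <= rho * N%:R ->
  let S := \sum_(mu < M)
    (expR (dotp (xi mu) xh) - expR (dotp (xi mu) (flip xh i))) in
  (xh i = xi l i -> 0 < S) /\ (xh i = - xi l i -> S < 0).
Proof.
move=> xi1 sep Mle xh1 near S.
pose z : R := expR 2; pose u : R := expR (- 2).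
have zu : z * u = 1 by rewrite /z /u -expRD subrr expR0.
have z1 : 1 < z by rewrite /z expR_gt1; lra.
have u0 : 0 < u by exact: expR_gt0.
have u1 : u < 1 by rewrite /u expR_lt1; lra.
pose F mu := expR (dotp (xi mu) xh) - expR (dotp (xi mu) (flip xh i)).
(* [L] bounds the exponential of [xi l] from below; [Q] bounds those of the other patterns from
   above, by the separation and the triangle inequality. *)
pose L := expR (N%:R - 2 * (rho * N%:R)).
pose Q := expR (N%:R - 2 * ((tau - rho) * N%:R)).
have L0 : 0 < L by exact: expR_gt0.
have Q0 : 0 < Q by exact: expR_gt0.
have FE mu : F mu = expR (dotp (xi mu) xh) * (1 - expR (- (2 * (xi mu i * xh i)))).
  by rewrite /F dotp_flip expRD; ring.
have Fle mu : mu != l -> `|F mu| <= Q * z.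
  move=> mul; rewrite FE normrM gtr0_norm ?expR_gt0//.
  apply: ler_pM => //.
    rewrite ler_expR dotp_pm1//.
    have := hamming_triangle (xi mu) xh (xi l); have := sep _ _ mul.
    by move: near; lra.
  (* The second factor is thus [1 - u] or [1 - z], in both cases at most [z] in absolute value. *)
  have : xi mu i * xh i = 1 \/ xi mu i * xh i = -1.
    by case: (xi1 mu i) => ->; case: (xh1 i) => ->; [left|right|right|left]; ring.
  case=> ->; rewrite ?mulrN mulr1 ?opprK -/u -/z.
    by rewrite gtr0_norm; lra.
  by rewrite ltr0_norm; lra.
have rest : `|\sum_(mu | mu != l) F mu| <= L * (1 - u) / 2.
  apply: (le_trans (ler_norm_sum _ _ _)).
  apply: (@le_trans _ _ (\sum_(mu < M) Q * z)).
    rewrite [leRHS](bigID (fun mu => mu != l))/=.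
    rewrite ler_wpDr//; last exact: ler_sum.
    by apply: sumr_ge0 => mu _; rewrite mulr_ge0// ltW// (lt_trans ltr01).
  rewrite sumr_const card_ord -[leLHS]mulr_natl.
  (* The exponential in the bound on [M] is exactly [L / Q], so [M] terms of size [Q * z] add up to
     at most [L * (1 - u) / 2]. *)
  have -> : L = expR (2 * N%:R * (tau - 2 * rho)) * Q.
    by rewrite /L /Q -expRD; congr expR; ring.
  have -> : expR (2 * N%:R * (tau - 2 * rho)) * Q * (1 - u) / 2 =
     expR (2 * N%:R * (tau - 2 * rho)) * (1 - u) / (2 * z) * (Q * z).
    by field; rewrite gt_eqF//; lra.
  by rewrite ler_wpM2r// mulr_ge0// ltW//; lra.
have SE : S = F l + \sum_(mu | mu != l) F mu by rewrite /S (bigD1 l).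
have Lle : L <= expR (dotp (xi l) xh).
  by rewrite ler_expR dotp_pm1// hamming_sym; move: near; lra.
have Lu0 : 0 < L * (1 - u) by rewrite mulr_gt0//; lra.
move: rest; rewrite ler_norml => /andP[lo hi].
have sq : xi l i * xi l i = 1 by case: (xi1 l i) => ->; ring.
split=> xhi; rewrite SE.
  have : L * (1 - u) <= F l.
    by rewrite FE xhi sq mulr1 -/u ler_wpM2r//; lra.
  by move: lo Lu0; lra.
have : L * (1 - u) <= - F l.
  rewrite FE xhi mulrN sq mulrN mulr1 opprK -/z -mulrN.
  apply: ler_pM => //; [exact: ltW | by lra |].
  (* A wrong bit gives the factor [z - 1] in place of [1 - u]. It is no smaller: expand
     [(z - 1) * (1 - u) >= 0] and use [z * u = 1]. *)
  suff : 2 <= z + u by lra.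
  have : 0 <= (z - 1) * (1 - u) by rewrite mulr_ge0//; lra.
  have -> : (z - 1) * (1 - u) = z + u - 1 - z * u by ring.
  by rewrite zu; lra.
by move: hi Lu0; lra.
Qed.

(** * Products of FAVOR++ features and their Gaussian moments *)

Section favor_features.
Context {R : realType} {N : nat}.
Implicit Types (s : R) (x y v : 'I_N -> R).

(** The deterministic prefactor of a product of two features: on sign vectors the two terms
    [Cc * normsq] sum to [-N]. *)
Definition favor_coef (r : nat) s : R := Dc N s ^+ 2 / r%:R * expR (- N%:R).

Definition favor_arg s x y : 'I_N -> R := fun j => Bc s * (x j + y j).

Lemma Ahat_gt0 s : 0 < s -> s < 1 -> 0 < Ahat s.
Proof. by move=> s0 s1; rewrite /Ahat opprB subr_gt0 invf_gt1. Qed.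

Lemma sqr_Bc s : 0 < s -> s < 1 -> Bc s ^+ 2 = 1 + 4 * Ahat s.
Proof.
by move=> s0 s1; have := Ahat_gt0 _ s0 s1 => A0; rewrite sqr_sqrtr//; lra.
Qed.

Lemma normsqZ (c : R) v : normsq (fun j => c * v j) = c ^+ 2 * normsq v.
Proof. by rewrite /normsq mulr_sumr; apply: eq_bigr => j _; rewrite exprMn. Qed.

(** Unbiasedness of FAVOR++ for the kernel [expR (dotp x y)]. The power in [gmgf] cancels [Dc ^ 2];
    since [Bc ^ 2 = 1 + 4 * Ahat], the exponent becomes [N + dotp x y], and [expR (- N)] removes the
    [N]. *)
Lemma favor_coef_gmgf (r : nat) s x y : 0 < s -> s < 1 ->
  pm1vec x -> pm1vec y ->
  favor_coef r s * gmgf (2 * Ahat s) (favor_arg s x y) =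
  r%:R^-1 * expR (dotp x y).
Proof.
move=> s0 s1 x1 y1; have A0 := Ahat_gt0 _ s0 s1.
rewrite /gmgf /favor_arg normsqZ sqr_Bc// normsq_add_pm1// /favor_coef /Dc.
have -> : 1 + 2 * (2 * Ahat s) = 1 + 4 * Ahat s by ring.
set v := 1 + 4 * Ahat s.
have v0 : 0 < v by rewrite /v; lra.
rewrite -powR_mulrn ?powR_ge0// -powRrM.
have -> : N%:R / 4 * 2 = N%:R / 2 :> R by field.
rewrite powRN.
have p0 : v `^ (N%:R / 2) != 0 by rewrite gt_eqF// powR_gt0.
have -> : v * (2 * N%:R + 2 * dotp x y) / (2 * v) = N%:R + dotp x y.
  by field; rewrite gt_eqF.
rewrite expRD expRN.
have e0 : expR N%:R != 0 :> R by rewrite gt_eqF ?expR_gt0.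
transitivity (r%:R^-1 * (v `^ (N%:R / 2) / v `^ (N%:R / 2)) *
   (expR N%:R / expR N%:R) * expR (dotp x y)); first by ring.
by rewrite !divff// !mulr1.
Qed.

(** Explains [Psi]: up to [r^-2] it is the expected product of four features on one row, which
    depends on the four vectors only through their sum [v]. *)
Lemma favor_coef_sqr_gmgf (r : nat) s x y x' y' v :
  (forall j, x j + y j + (x' j + y' j) = v j) ->
  favor_coef r s * favor_coef r s *
    gmgf (2 * Ahat s + 2 * Ahat s)
      (fun j => favor_arg s x y j + favor_arg s x' y' j) =
  r%:R^-1 ^+ 2 * Psi s v.
Proof.
move=> vE; rewrite /gmgf.
have -> : (fun j => favor_arg s x y j + favor_arg s x' y' j) =
          (fun j => Bc s * v j).
  by apply/funext => j; rewrite /favor_arg -mulrDr vE.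
rewrite normsqZ /Psi /favor_coef.
have -> : 1 + 2 * (2 * Ahat s + 2 * Ahat s) = 1 + 8 * Ahat s by ring.
have -> : - (2 * N%:R) = - N%:R + - N%:R :> R by ring.
have -> : Bc s ^+ 2 / (2 * (1 + 8 * Ahat s)) * normsq v =
          Bc s ^+ 2 * normsq v / (2 * (1 + 8 * Ahat s)) by ring.
by rewrite [expR (- N%:R + - N%:R)]expRD; ring.
Qed.

Lemma phiFppM (r : nat) s (w : 'I_r -> 'I_N -> R) x y k :
  pm1vec x -> pm1vec y ->
  phiFpp s w x k * phiFpp s w y k =
  favor_coef r s *
    expR (- (2 * Ahat s) * normsq (w k) + dotp (w k) (favor_arg s x y)).
Proof.
move=> x1 y1.
rewrite /phiFpp /favor_coef (normsq_pm1 _ x1) (normsq_pm1 _ y1).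
have rr : Num.sqrt r%:R ^+ 2 = r%:R :> R by rewrite sqr_sqrtr.
have -> : Dc N s ^+ 2 / r%:R = (Dc N s / Num.sqrt r%:R) ^+ 2.
  by rewrite exprMn exprVn rr.
rewrite mulrACA -expr2 -[RHS]mulrA -!expRD; congr (_ * expR _).
have -> : dotp (w k) (favor_arg s x y) =
    Bc s * dotp (w k) x + Bc s * dotp (w k) y.
  rewrite /dotp !mulr_sumr -big_split/=; apply: eq_bigr => j _.
  by rewrite /favor_arg; ring.
by rewrite /Cc; field.
Qed.

End favor_features.

(** * Mean and variance of the energy difference *)

Theorem theorem2 (R : realType) (d : measure_display) (T : measurableType d)
  (P : probability T R) (N M r : nat) (s tau rho : R)
  (xi : 'I_M -> 'I_N -> R) (l : 'I_M) (xh : 'I_N -> R) (i : 'I_N)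
  (omega : 'I_r -> 'I_N -> {RV P >-> R}) :
  (0 < N)%N -> (0 < M)%N -> (0 < r)%N ->
  0 < s -> s < 1 ->
  (forall mu, pm1vec (xi mu)) ->
  0 < tau ->
  (forall mu nu : 'I_M, mu != nu -> tau * N%:R <= (hamming (xi mu) (xi nu))%:R) ->
  0 < rho -> rho < tau / 2 ->
  M%:R <= expR (2 * N%:R * (tau - 2 * rho)) * (1 - expR (-2)) / (2 * expR 2) ->
  pm1vec xh ->
  (hamming xh (xi l))%:R <= rho * N%:R ->
  iid_std_normal omega ->
  let xt := flip xh i in
  let om := fun (t : T) (k : 'I_r) (j : 'I_N) => omega k j t in
  let DeltaE := fun t : T => Erand s (om t) xi xt - Erand s (om t) xi xh in
  let V1 := \sum_(m1 < M) \sum_(m2 < M)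
              Psi s (fun j => xi m1 j + xi m2 j + 2 * xh j) in
  let V2 := \sum_(m1 < M) \sum_(m2 < M)
              Psi s (fun j => xi m1 j + xi m2 j + 2 * xt j) in
  let V3 := \sum_(m1 < M) \sum_(m2 < M)
              Psi s (fun j => xi m1 j + xi m2 j + xh j + xt j) in
  let V4 := \sum_(m1 < M) \sum_(m2 < M)
              expR (dotp (xi m1) xh) * expR (dotp (xi m2) xh) in
  let V5 := \sum_(m1 < M) \sum_(m2 < M)
              expR (dotp (xi m1) xt) * expR (dotp (xi m2) xt) in
  let V6 := \sum_(m1 < M) \sum_(m2 < M)
              expR (dotp (xi m1) xh) * expR (dotp (xi m2) xt) in
  ((xh i = xi l i -> (0 < 'E_P[DeltaE])%E) /\
   (xh i = - xi l i -> ('E_P[DeltaE] < 0)%E)) /\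
  'V_P[DeltaE] = ((r%:R)^-1 * (V1 + V2 - 2 * V3 - V4 - V5 + 2 * V6))%:E.
Proof.
move=> N0 M0 r0 s0 s1 xi1 tau0 sep rho0 rhotau Mle xh1 near iid.
move=> xt om DeltaE V1 V2 V3 V4 V5 V6.
have xt1 : pm1vec xt by exact: flip_pm1.
have rn0 : r%:R != 0 :> R by rewrite pnatr_eq0 -lt0n.
have A0 : 0 <= 2 * Ahat s by rewrite mulr_ge0// ltW// Ahat_gt0.
pose K : R := @favor_coef R N r s.
(* The flag is true for [xh] and false for [xt]. The minus sign in [memM] reverses the difference,
   so the [xh] terms carry [+K]. *)
pose c (q : 'I_M * bool) := if q.2 then K else - K.
pose b (q : 'I_M * bool) := favor_arg s (xi q.1) (if q.2 then xh else xt).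
have DeltaEE :
    DeltaE = fun t => \sum_(k < r) \sum_q c q * gexp omega (2 * Ahat s) (b q) k t.
  apply/funext => t; rewrite /DeltaE /Erand -sumrB; apply: eq_bigr => k _.
  rewrite -(pair_bigA _ (fun mu e => c (mu, e) *
    gexp omega (2 * Ahat s) (b (mu, e)) k t))/=.
  rewrite /memM 2!mulrN opprK addrC !mulr_sumr -sumrB; apply: eq_bigr => mu _.
  rewrite big_bool/= /c /b/= mulNr.
  by rewrite [X in X - _]mulrC [X in _ - X]mulrC !phiFppM.
have [EX VX] := @moments_sum_gexp R d T P r N omega _ (2 * Ahat s) c b iid A0.
rewrite -DeltaEE in EX VX.
pose S1 := \sum_q c q * gmgf (2 * Ahat s) (b q).
rewrite -/S1 in EX VX.
pose S := \sum_(mu < M) (expR (dotp (xi mu) xh) - expR (dotp (xi mu) xt)).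
(* By unbiasedness the mean [r * S1] is the exact exponential energy gap [S], whose sign is
   known. *)
have S1E : S1 = r%:R^-1 * S.
  rewrite /S1 -(pair_bigA _ (fun mu e => c (mu, e) *
    gmgf (2 * Ahat s) (b (mu, e))))/=.
  rewrite /S mulr_sumr; apply: eq_bigr => mu _.
  rewrite big_bool/= /c /b/= mulNr !favor_coef_gmgf//.
  by rewrite mulrBr.
have [Spos Sneg] := energy_gap_sign R N M tau rho xi l xh i xi1 sep Mle xh1 near.
split.
  rewrite EX S1E mulrA divff// mul1r lte_fin.
  by split=> [/Spos|/Sneg].
rewrite VX; congr EFin.
have SE : S ^+ 2 = V4 + V5 - 2 * V6.
  have -> : S = \sum_(mu < M) expR (dotp (xi mu) xh) -
                \sum_(mu < M) expR (dotp (xi mu) xt) by rewrite -sumrB.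
  have sumM (f g : 'I_M -> R) :
      \sum_(m1 < M) \sum_(m2 < M) f m1 * g m2 = (\sum_m f m) * (\sum_m g m).
    by rewrite mulr_suml; apply: eq_bigr => m1 _; rewrite mulr_sumr.
  by rewrite /V4 /V5 /V6 !sumM; ring.
pose S2 := \sum_q \sum_q' c q * c q' *
  gmgf (2 * Ahat s + 2 * Ahat s) (fun j => b q j + b q' j).
rewrite -/S2.
(* The four choices of flags yield [V1], [V2] and, with negative sign, [V3] twice. *)
have S2E : S2 = r%:R^-1 ^+ 2 * (V1 + V2 - 2 * V3).
  pose g m1 m2 :=
    Psi s (fun j => xi m1 j + xi m2 j + 2 * xh j) +
    Psi s (fun j => xi m1 j + xi m2 j + 2 * xt j) -
    2 * Psi s (fun j => xi m1 j + xi m2 j + xh j + xt j).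
  transitivity (\sum_(m1 < M) \sum_(m2 < M) r%:R^-1 ^+ 2 * g m1 m2); last first.
    under eq_bigr do rewrite -mulr_sumr sumrB big_split/=.
    rewrite -mulr_sumr sumrB big_split/=; congr (_ * (_ - _)).
    by rewrite /V3 mulr_sumr; apply: eq_bigr => m1 _; rewrite mulr_sumr.
  pose h (q q' : 'I_M * bool) := c q * c q' *
    gmgf (2 * Ahat s + 2 * Ahat s) (fun j => b q j + b q' j).
  rewrite /S2 -(pair_bigA _ (fun m1 e1 => \sum_q' h (m1, e1) q'))/=.
  apply: eq_bigr => m1 _; rewrite big_bool/=.
  rewrite -(pair_bigA _ (fun m2 e2 => h (m1, true) (m2, e2)))/=.
  rewrite -(pair_bigA _ (fun m2 e2 => h (m1, false) (m2, e2)))/=.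
  rewrite -big_split/=; apply: eq_bigr => m2 _; rewrite !big_bool/= /h /c /b/=.
  rewrite [- K * - K]mulrNN [K * - K]mulrN [- K * K]mulNr.
  have gE := @favor_coef_sqr_gmgf R N r s.
  rewrite !mulNr (gE _ _ _ _ (fun j => xi m1 j + xi m2 j + 2 * xh j)) => [|j];
    last by ring.
  rewrite (gE _ _ _ _ (fun j => xi m1 j + xi m2 j + xh j + xt j)) => [|j];
    last by ring.
  rewrite (gE _ _ _ _ (fun j => xi m1 j + xi m2 j + xh j + xt j)) => [|j];
    last by ring.
  rewrite (gE _ _ _ _ (fun j => xi m1 j + xi m2 j + 2 * xt j)) => [|j];
    last by ring.
  by rewrite /g; ring.
(* Both [S2] and [S1 ^ 2] carry [r^-2], so the factor [r] of the variance leaves [r^-1]. *)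
rewrite S2E S1E exprMn SE; field.
exact: rn0.
Qed.
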